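(* Let $h\colon\mathbb{N}_2\to\mathbb{C}$ be a light weight. Suppose that $D_h(1)_1$, $C_h(1)_1$, $B_h(1)_1$ and $A_h(1)_1$ exist. Then $B_h(1)_1\ne0$ and $$A_h(1)_1=\Big(1-\frac{1}{B_h(1)_1}\Big)D_h(1)_1.$$
   Context: $\mathbb{N}=\{1,2,\dots\}$, $\mathbb{N}_0=\{0,1,2,\dots\}$, and $\mathbb{N}_2=\{e\subset\mathbb{N}:|e|=2\}$ is the edge set of the countable complete graph on $\mathbb{N}$. A weight is a map $h\colon\mathbb{N}_2\to\mathbb{C}$. A walk of length $n\in\mathbb{N}_0$ is a tuple $w=\langle v_0,\dots,v_n\rangle$ of elements of $\mathbb{N}$ with $v_{i-1}\ne v_i$ for $i=1,\dots,n$; its weight is $h(w)=\prod_{i=1}^n h(\{v_{i-1},v_i\})$ (and $h(w)=1$ if $n=0$). A series $\sum_{x\in X}g(x)$ over an at most countable set $X$ converges absolutely if the sums $\sum_{x\in Y}|g(x)|$ over finite $Y\subset X$ are bounded; then its sum is independent of the order of summation. For a set $W$ of walks, $h(W)$ denotes the sum of $\sum_{w\in W}h(w)$ when it converges absolutely. $W(n)$ is the set of walks of length $n$ with $v_0=1$. The weight $h$ is light if $\sum_{w\in W(n)}h(w)$ converges absolutely for every $n\in\mathbb{N}_0$. Define, in $\mathbb{C}[[x]]$: $A_h(x)=\sum_{n\ge0}a_n^hx^n$ with $a_n^h=h(W(1,n))$, where $W(1,n)$ is the set of walks in $W(n)$ with $v_i=1$ for some $i\in\{1,\dots,n\}$;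 $B_h(x)=\sum_{n\ge0}b_n^hx^n$ with $b_n^h=h(W_b(n))$, where $W_b(n)$ is the set of walks of length $n$ with $v_0=v_n=1$; $C_h(x)=\sum_{n\ge0}c_n^hx^n$ with $c_n^h=h(W_c(n))$, where $W_c(0)=\emptyset$ and for $n\ge1$, $W_c(n)$ is the set of walks of length $n$ with $v_0=v_n=1$ and $v_i\ne1$ for $0<i<n$; $D_h(x)=\sum_{n\ge0}d_n^hx^n$ with $d_n^h=h(W(n))$. For $U(x)=\sum_{n\ge0}u_nx^n\in\mathbb{C}[[x]]$, we say $U(1)_1$ exists if $\lim_{n\to\infty}\sum_{j=0}^nu_j$ exists in $\mathbb{C}$, and $U(1)_1$ denotes this limit. *)

(* Defs.v *)
From mathcomp Require Import all_boot all_order all_algebra finmap.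
From mathcomp Require Import all_classical all_reals all_analysis.
From mathcomp Require Import showcase.summability.
From mathcomp Require Import complex.

Set Implicit Arguments.
Unset Strict Implicit.
Unset Printing Implicit Defensive.

Import Order.TTheory GRing.Theory Num.Theory.
Import numFieldNormedType.Exports.

Local Open Scope classical_set_scope.
Local Open Scope fset_scope.
Local Open Scope ring_scope.
Local Open Scope complex_scope.

Definition vertex : Type := {v : nat | (0 < v)%N}.

Definition v1 : vertex := exist _ 1%N isT.

Definition edge : Type := {e : {fset vertex} | #|` e| == 2%N}.

Section Sums.
Context {R : realType} {T : choiceType}.

Definition absolutely_summable (X : set T) (g : T -> R[i]) : Prop :=
  exists M : R, forall Y : {fset T}, {subset Y <= X} ->
    \sum_(x <- Y) `|g x| <= M%:C.

(* [summability.sum] is the limit of the finite partial sums along the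
   directed family of all finite sets of indices, so no order of summation is
   chosen. It is meaningful when
   [absolutely_summable X g] holds and is a default value when the partial
   sums do not converge. *)
Definition unordered_sum (X : set T) (g : T -> R[i]) : R[i] :=
  @summability.sum T _ R[i]^o (fun x => if x \in X then g x else 0).

End Sums.

(* The walk <v_0, ..., v_n> is the sequence [:: v_0; ...; v_n] of size n + 1. *)
Definition walks (n : nat) : set (seq vertex) :=
  [set w | size w = n.+1 /\
           forall i, (0 < i <= n)%N -> nth v1 w i.-1 != nth v1 w i].

Section Weights.
Context {R : realType}.
Implicit Types (h : edge -> R[i]) (n : nat).

(* h({u, v}). The value 0 is used only if u = v, which does not occur for
   consecutive vertices of a walk. *)
Definition edge_weight h (u v : vertex) : R[i] :=
  oapp h 0 (insub [fset u; v]).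

Definition walk_weight h (w : seq vertex) : R[i] :=
  \prod_(1 <= i < size w) edge_weight h (nth v1 w i.-1) (nth v1 w i).

Definition set_weight h (W : set (seq vertex)) : R[i] :=
  unordered_sum W (walk_weight h).

Definition W (n : nat) : set (seq vertex) :=
  [set w | walks n w /\ nth v1 w 0 = v1].

Definition W_ret (n : nat) : set (seq vertex) :=
  [set w | W n w /\ exists2 i, (1 <= i <= n)%N & nth v1 w i = v1].

Definition W_b (n : nat) : set (seq vertex) :=
  [set w | [/\ walks n w, nth v1 w 0 = v1 & nth v1 w n = v1]].

Definition W_c (n : nat) : set (seq vertex) :=
  if n is 0 then set0
  else [set w | [/\ walks n w, nth v1 w 0 = v1, nth v1 w n = v1 &
                    forall i, (0 < i < n)%N -> nth v1 w i <> v1]].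

Definition light h : Prop :=
  forall n, absolutely_summable (W n) (walk_weight h).

(* A formal power series in C[[x]] is given by its sequence of coefficients. *)
Definition A_ h : nat -> R[i] := fun n => set_weight h (W_ret n).
Definition B_ h : nat -> R[i] := fun n => set_weight h (W_b n).
Definition C_ h : nat -> R[i] := fun n => set_weight h (W_c n).
Definition D_ h : nat -> R[i] := fun n => set_weight h (W n).

Definition partial_sums (u : nat -> R[i]) : nat -> R[i] :=
  fun n => \sum_(0 <= j < n.+1) u j.

(* For U(x) = \sum_n u_n x^n, [value1_exists u] says that U(1)_1 exists and
   [value1 u] is U(1)_1. The regular algebra R[i]^o carries the topology given
   by the complex modulus; R[i] itself has no declared topology. *)
Definition value1_exists (u : nat -> R[i]) : Prop :=
  cvg ((partial_sums u : nat -> R[i]^o) @ \oo).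

Definition value1 (u : nat -> R[i]) : R[i] := 
  lim ((partial_sums u : nat -> R[i]^o) @ \oo).

End Weights.

(* Main.v *)
(* Cutting a walk at its first return to 1 gives the identities of formal
   series A = C D and B = 1 + C B. By Abel's theorem on Cauchy products, proved
   by averaging partial sums instead of through power series, these identities
   hold for the values at 1, so that B(1) (1 - C(1)) = 1 and A(1) = C(1) D(1). *)

Require Import Defs.
From mathcomp Require Import all_boot all_order all_algebra finmap.
From mathcomp Require Import all_classical all_reals all_analysis.
From mathcomp Require Import complex.
From mathcomp Require Import zify showcase.summability.

Set Implicit Arguments.
Unset Strict Implicit.
Unset Printing Implicit Defensive.

Import Order.TTheory GRing.Theory Num.Theory.
Import numFieldNormedType.Exports ComplexField.Normc.

Local Open Scope classical_set_scope.
Local Open Scope fset_scope.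
Local Open Scope ring_scope.
Local Open Scope complex_scope.

(** * Cauchy products of convergent series *)

Section ComplexNorm.
Context {R : realType}.

Lemma normcC (z : R[i]) : `|z| = (normc z)%:C.
Proof. by []. Qed.

Lemma normc_ge0 (z : R[i]) : 0 <= normc z.
Proof. by rewrite -ler0c -normcC. Qed.

(** Turns complex limits into real ones, so that squeezing and the real Cesàro theorem apply. *)
Lemma cvg_complexP {T : Type} {F : set_system T} {FF : Filter F}
    (f : T -> R[i]^o) (l : R[i]^o) :
  f @ F --> l <-> (fun t => normc (f t - l)) @ F --> (0 : R).
Proof.
split=> [/cvgrPdist_lt fl|/cvgrPdist_lt fl].
  apply/cvgrPdist_lt => e e0.
  have /fl : 0 < e%:C by rewrite ltcR.
  apply: filterS => t.
  by rewrite distrC normcC ltcR sub0r normrN ger0_norm ?normc_ge0.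
apply/cvgrPdist_lt => e e0.
(* A positive element of [R[i]] is real, so [e] is its own real part. *)
have eE : e = (complex.Re e)%:C by rewrite RRe_real// gtr0_real.
have /fl : 0 < complex.Re e by rewrite -ltcR -eE.
apply: filterS => t.
by rewrite sub0r normrN ger0_norm ?normc_ge0// distrC normcC eE ltcR.
Qed.

Lemma normc_real (x : R) : normc x%:C = `|x|.
Proof. by rewrite /= expr0n/= addr0 sqrtr_sqr. Qed.

Lemma normc_sum (I : Type) (s : seq I) (F : I -> R[i]) :
  normc (\sum_(i <- s) F i) <= \sum_(i <- s) normc (F i).
Proof.
elim/big_ind2: _ => [|x y z t xy zt|//]; first by rewrite normc0.
by rewrite (le_trans (le_normcD _ _))// lerD.
Qed.

Lemma cvg_real_complex {T : Type} {F : set_system T} {FF : Filter F}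
    (f : T -> R) (l : R) :
  f @ F --> l -> (fun t => (f t)%:C : R[i]^o) @ F --> (l%:C : R[i]^o).
Proof.
move=> /cvgrPdist_lt fl; apply/cvg_complexP/cvgrPdist_lt => e e0.
have := fl _ e0; apply: filterS => t.
rewrite sub0r normrN (ger0_norm (normc_ge0 _)).
by rewrite -(rmorphB (real_complex R)) normc_real distrC.
Qed.

End ComplexNorm.

(** * Abel's theorem through Cesàro means *)

Section CauchyProduct.
Context {R : realType}.
Implicit Types u v : nat -> R[i].

Definition cauchy_prod u v n := \sum_(k < n.+1) u k * v (n - k)%N.

Lemma cauchy_prodC u v : cauchy_prod u v =1 cauchy_prod v u.
Proof.
move=> n; rewrite /cauchy_prod (reindex_inj rev_ord_inj)/=.
apply: eq_bigr => k _; have kn : (k <= n)%N by rewrite -ltnS.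
by rewrite subSS (subKn kn) mulrC.
Qed.

Lemma cauchy_prodS u v n :
  cauchy_prod u v n.+1 = \sum_(k < n.+1) u k * v (n.+1 - k)%N + u n.+1 * v 0%N.
Proof. by rewrite /cauchy_prod big_ord_recr/= subnn. Qed.

Lemma partial_sums0 u : partial_sums u 0 = u 0%N.
Proof. by rewrite /partial_sums big_nat1. Qed.

Lemma partial_sumsS u n : partial_sums u n.+1 = partial_sums u n + u n.+1.
Proof. by rewrite /partial_sums big_nat_recr. Qed.

(** Taking partial sums is multiplication by 1/(1 - x), a factor that can be moved onto [v]. *)
Lemma partial_sums_cauchy_prod u v :
  partial_sums (cauchy_prod u v) =1 cauchy_prod u (partial_sums v).
Proof.
elim=> [|n IHn].
  by rewrite partial_sums0 /cauchy_prod !big_ord1 partial_sums0.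
rewrite partial_sumsS IHn !cauchy_prodS partial_sums0 addrA; congr (_ + _).
rewrite /cauchy_prod -big_split/=; apply: eq_bigr => k _.
have kn : (k <= n)%N by rewrite -ltnS.
by rewrite -mulrDr (subSn kn) partial_sumsS.
Qed.

(** Multiplication by 1/(1 - x)^2, with one factor 1/(1 - x) given to each series. *)
Lemma partial_sums2_cauchy_prod u v :
  partial_sums (partial_sums (cauchy_prod u v)) =1
  cauchy_prod (partial_sums u) (partial_sums v).
Proof.
move=> n; rewrite cauchy_prodC -partial_sums_cauchy_prod.
by apply: eq_big_nat => i _; rewrite partial_sums_cauchy_prod cauchy_prodC.
Qed.

Definition mean (u : nat -> R[i]) n : R[i] := n.+1%:R^-1 * partial_sums u n.

Lemma normc_mean n (F : nat -> R[i]) :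
  normc (n.+1%:R^-1 * \sum_(k < n.+1) F k) <=
  n.+1%:R^-1 * \sum_(k < n.+1) normc (F k).
Proof.
rewrite normcM normcV -(mulr1n 1) normcMn normc1.
by rewrite ler_wpM2l ?normc_sum// invr_ge0.
Qed.

Lemma mean_cst n (l : R[i]) : n.+1%:R^-1 * \sum_(k < n.+1) l = l.
Proof. by rewrite sumr_const card_ord -[l *+ _]mulr_natl mulKf// pnatr_eq0. Qed.

(** Cesàro's theorem for the real sequence of distances to [l]. Averaging the distances, not the
    terms, gives the error bound for means of products as well. *)
Lemma cvg_mean_normc (u : nat -> R[i]^o) (l : R[i]^o) : u @ \oo --> l ->
  (fun n => n.+1%:R^-1 * \sum_(k < n.+1) normc (u k - l)) @ \oo --> (0 : R).
Proof.
move=> /cvg_complexP/cesaro ul.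
suff -> : (fun n => n.+1%:R^-1 * \sum_(k < n.+1) normc (u k - l)) =
  arithmetic_mean (fun n => normc (u n - l)) by [].
by apply/funext => n; rewrite /arithmetic_mean /= seriesEnat/= big_mkord.
Qed.

Lemma cesaro_complex (u : nat -> R[i]^o) (l : R[i]^o) :
  u @ \oo --> l -> (mean u : nat -> R[i]^o) @ \oo --> l.
Proof.
move=> ul; apply/cvg_complexP.
apply: squeeze_cvgr (cvg_cst 0) (cvg_mean_normc ul).
apply: nearW => n; rewrite normc_ge0/=.
rewrite /mean /partial_sums big_mkord -{1}(mean_cst n l) -mulrBr -sumrB.
exact: (normc_mean n (fun k => u k - l)).
Qed.

(** Write u_k v_{n-k} - l m = (u_k - l) v_{n-k} + l (v_{n-k} - m). As [v] is bounded, the average of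
    each term over k tends to 0. *)
Lemma cvg_mean_cauchy_prod (u v : nat -> R[i]^o) (l m : R[i]^o) :
  u @ \oo --> l -> v @ \oo --> m ->
  (fun n => n.+1%:R^-1 * cauchy_prod u v n : R[i]^o) @ \oo --> l * m.
Proof.
move=> ul vm; apply/cvg_complexP.
have [M M0 vM] : exists2 M : R, 0 <= M & forall n, normc (v n) <= M.
  have vR : cvgn (fun n => normc (v n - m)).
    by apply/cvg_ex; exists 0; exact/cvg_complexP.
  have /cvg_seq_bounded/pinfty_ex_gt0[M M0 vM] := vR.
  exists (M + normc m) => [|n]; first by rewrite addr_ge0 ?normc_ge0// ltW.
  rewrite -[v n](subrK m) (le_trans (le_normcD _ _))// lerD2r.
  by rewrite (le_trans (ler_norm _))// vM.
have H : (fun n => M * (n.+1%:R^-1 * \sum_(k < n.+1) normc (u k - l)) +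
     normc l * (n.+1%:R^-1 * \sum_(k < n.+1) normc (v k - m))) @ \oo
     --> (M * 0 + normc l * 0 : R).
  by apply: cvgD; apply: cvgMl_tmp; exact: cvg_mean_normc.
rewrite !mulr0 addr0 in H.
apply: squeeze_cvgr (cvg_cst 0) H.
apply: nearW => n; rewrite normc_ge0/= -{1}(mean_cst n (l * m)) -mulrBr -sumrB.
apply: le_trans (normc_mean n (fun k => u k * v (n - k)%N - l * m)) _.
rewrite (mulrCA M) (mulrCA (normc l)) -mulrDr ler_wpM2l ?invr_ge0//.
(* Reversing the second sum replaces v_k by v_{n-k}, so that the bound can be checked term by
   term. *)
rewrite [X in _ <= _ + _ * X](reindex_inj rev_ord_inj)/=.
rewrite !mulr_sumr -big_split/=; apply: ler_sum => k _; rewrite subSS.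
set w := v _.
have -> : u k * w - l * m = (u k - l) * w + l * (w - m).
  by rewrite mulrBr mulrBl addrA subrK.
rewrite (le_trans (le_normcD _ _))// !normcM lerD2r mulrC.
by rewrite ler_wpM2r ?normc_ge0 ?vM.
Qed.

(** The Cesàro means of the partial sums of the product have two limits: [value1 (cauchy_prod u v)]
    by Cesàro's theorem and, after [partial_sums2_cauchy_prod], the product of the two values. *)
Lemma value1_cauchy_prod u v : value1_exists u -> value1_exists v ->
  value1_exists (cauchy_prod u v) ->
  value1 (cauchy_prod u v) = value1 u * value1 v.
Proof.
move=> cu cv cuv.
apply: (cvg_unique (@norm_hausdorff _ _) _ (cvg_mean_cauchy_prod cu cv)).
have := cesaro_complex cuv.
suff -> : mean (partial_sums (cauchy_prod u v)) = (fun n =>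
    n.+1%:R^-1 * cauchy_prod (partial_sums u) (partial_sums v) n) by [].
by apply/funext => n; rewrite /mean partial_sums2_cauchy_prod.
Qed.

End CauchyProduct.

(** * Unordered sums *)

(* In its library file this instance is local to a section. *)
#[local] Existing Instance totally_filter.

Section UnorderedSums.
Context {R : realType}.

Definition abs_summable {T : choiceType} (f : T -> R[i]) : Prop :=
  exists M : R, forall Y : {fset T}, \sum_(x <- Y) normc (f x) <= M.

Definition has_sum {T : choiceType} (f : T -> R[i]) (l : R[i]) : Prop :=
  (partial_sum f : {fset T} -> R[i]^o) @ totally --> (l : R[i]^o).

Lemma partial_sumE {T : choiceType} {V : zmodType} (f : T -> V) (A : {fset T}) :
  partial_sum f A = \sum_(x <- A) f x.
Proof. by rewrite /partial_sum big_seq_fsetE. Qed.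

Lemma has_sum_unique {T : choiceType} (f : T -> R[i]) l m :
  has_sum f l -> has_sum f m -> l = m.
Proof. exact: (@norm_cvg_unique _ R[i]^o). Qed.

(** The integrand inside [unordered_sum], named so that sums over subsets become sums over the whole
    type. *)
Definition zero_ext {T : choiceType} (X : set T) (g : T -> R[i]) (x : T) :=
  if x \in X then g x else 0.

Lemma has_sumE {T : choiceType} (X : set T) (g : T -> R[i]) l :
  has_sum (zero_ext X g) l -> unordered_sum X g = l.
Proof. exact: (cvg_lim (@norm_hausdorff _ R[i]^o)). Qed.

Lemma has_sumP {T : choiceType} (f : T -> R[i]) l :
  has_sum f l <-> forall e : R, 0 < e -> exists A : {fset T},
    forall B : {fset T}, A `<=` B -> normc (\sum_(x <- B) f x - l) < e.
Proof.
split=> [/cvg_complexP/cvgrPdist_lt H e /H[A _ AH]|H].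
  exists A => B /AH/=; rewrite partial_sumE sub0r normrN.
  by rewrite (ger0_norm (normc_ge0 _)).
apply/cvg_complexP/cvgrPdist_lt => e /H[A AH]; exists A => // B /= /AH.
by rewrite partial_sumE sub0r normrN (ger0_norm (normc_ge0 _)).
Qed.

Lemma sum_fset_le {T : choiceType} (f : T -> R) (A B : {fset T}) :
  (forall x, 0 <= f x) -> A `<=` B -> \sum_(x <- A) f x <= \sum_(x <- B) f x.
Proof.
move=> f0 AB; rewrite [leRHS](big_fsetID _ (mem A))/=.
have -> : [fset x in B | x \in A] = A.
  by apply/fsetP => x; rewrite !inE/= andb_idl// => /(fsubsetP AB).
by rewrite lerDl sumr_ge0.
Qed.

(** Finite sums of nonnegative terms grow with the index set, so they converge to their supremum. *)
Lemma cvg_nonneg_sums {T : choiceType} (f : T -> R) (M : R) :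
  (forall x, 0 <= f x) -> (forall Y : {fset T}, \sum_(x <- Y) f x <= M) ->
  exists l : R, partial_sum f @ totally --> l.
Proof.
move=> f0 fM; pose E := range (fun Y : {fset T} => \sum_(x <- Y) f x).
have supE : has_sup E.
  by split; [exists (\sum_(x <- fset0) f x), fset0 | exists M => _ [Y _ <-]].
exists (sup E); apply/cvgrPdist_lt => e e0.
have [_ [A _ <-] AE] := sup_adherent e0 supE.
exists A => // B /= AB; rewrite partial_sumE.
have BE : \sum_(x <- B) f x <= sup E by apply: ub_le_sup; [case: supE|exists B].
rewrite ger0_norm ?subr_ge0// ltrBlDr -ltrBlDl.
by rewrite (lt_le_trans _ (sum_fset_le f0 AB)).
Qed.

Lemma has_sumD {T : choiceType} (f g : T -> R[i]) l m :
  has_sum f l -> has_sum g m -> has_sum (fun x => f x + g x) (l + m).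
Proof.
move=> fl gm; rewrite /has_sum.
suff -> : partial_sum (fun x => f x + g x) =
    (partial_sum f \+ partial_sum g : {fset T} -> R[i]^o) by exact: cvgD.
by apply/funext => A; rewrite /partial_sum/= big_split.
Qed.

Lemma has_sum0 {T : choiceType} : has_sum (fun _ : T => 0) 0.
Proof.
rewrite /has_sum.
suff -> : partial_sum (fun _ : T => 0) = (fun=> 0 : R[i]^o) by exact: cvg_cst.
by apply/funext => A; rewrite /partial_sum/= big1.
Qed.

Lemma has_sum_sum {T : choiceType} (I : Type) (s : seq I) (f : I -> T -> R[i])
    (l : I -> R[i]) :
  (forall i, has_sum (f i) (l i)) ->
  has_sum (fun x => \sum_(i <- s) f i x) (\sum_(i <- s) l i).
Proof.
move=> fl; elim: s => [|i s IHs].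
  rewrite big_nil; suff -> : (fun x : T => \sum_(i <- [::]) f i x) = fun=> 0.
    exact: has_sum0.
  by apply/funext => x; rewrite big_nil.
rewrite big_cons.
have -> : (fun x : T => \sum_(j <- i :: s) f j x) =
    fun x => f i x + \sum_(j <- s) f j x.
  by apply/funext => x; rewrite big_cons.
exact: (has_sumD (fl i) IHs).
Qed.

Lemma has_sumM {T : choiceType} (c : R[i]) (f : T -> R[i]) l :
  has_sum f l -> has_sum (fun x => c * f x) (c * l).
Proof.
move=> fl; rewrite /has_sum.
suff -> : partial_sum (fun x => c * f x) =
   (fun A => c *: (partial_sum f A : R[i]^o)) by exact: cvgZl_tmp.
by apply/funext => A; rewrite /partial_sum/= -mulr_sumr.
Qed.

Lemma has_sum_real {T : choiceType} (f : T -> R) (l : R) :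
  partial_sum f @ totally --> l -> has_sum (fun x => (f x)%:C) l%:C.
Proof.
move=> /cvg_real_complex; rewrite /has_sum.
suff -> : partial_sum (fun x => (f x)%:C) = fun A => (partial_sum f A)%:C by [].
by apply/funext => A; rewrite /partial_sum rmorph_sum.
Qed.

Lemma normrRe_le (z : R[i]) : `|complex.Re z| <= normc z.
Proof. by rewrite -lecR; exact: normc_ge_Re. Qed.

Lemma normrIm_le (z : R[i]) : `|complex.Im z| <= normc z.
Proof.
case: z => a b /=; rewrite -[X in X <= _]sqrtr_sqr.
by rewrite ler_wsqrtr// lerDr sqr_ge0.
Qed.

(** Write f = |f| - (|f| - f): both parts are nonnegative, with finite sums bounded by [M] and
    [M + M]. *)
Lemma cvg_real_sums {T : choiceType} (f : T -> R) (M : R) :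
  (forall Y : {fset T}, \sum_(x <- Y) `|f x| <= M) ->
  exists l : R[i], has_sum (fun x => (f x)%:C) l.
Proof.
move=> fM.
have [l fl] : exists l : R, partial_sum (fun x => `|f x|) @ totally --> l.
  by apply: (@cvg_nonneg_sums _ _ M) => //= x.
have [m fm] : exists m : R,
    partial_sum (fun x => `|f x| - f x) @ totally --> m.
  apply: (@cvg_nonneg_sums _ _ (M + M)) => [x|Y].
    by rewrite subr_ge0 ler_norm.
  rewrite (le_trans _ (lerD (fM Y) (fM Y)))// -big_split/=.
  by apply: ler_sum => x _; rewrite lerD2l -normrN ler_norm.
exists (l%:C + -1 * m%:C).
have := has_sumD (has_sum_real fl) (has_sumM (c := -1) (has_sum_real fm)).
congr (has_sum _ _); apply/funext => x /=.
by rewrite rmorphB/= mulN1r opprB addrCA subrr addr0.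
Qed.

Lemma abs_summable_has_sum {T : choiceType} (f : T -> R[i]) :
  abs_summable f -> exists l, has_sum f l.
Proof.
move=> [M fM].
have [a fa] : exists l : R[i], has_sum (fun x => (complex.Re (f x))%:C) l.
  apply: (@cvg_real_sums _ _ M) => Y; apply: le_trans (fM Y).
  by apply: ler_sum => x _; exact: normrRe_le.
have [b fb] : exists l : R[i], has_sum (fun x => (complex.Im (f x))%:C) l.
  apply: (@cvg_real_sums _ _ M) => Y; apply: le_trans (fM Y).
  by apply: ler_sum => x _; exact: normrIm_le.
exists (a + 'i%C * b); have := has_sumD fa (has_sumM (c := 'i%C) fb).
by congr (has_sum _ _); apply/funext => x; rewrite -complexE.
Qed.

Lemma sum_fsetM {T1 T2 : choiceType} (V : comPzRingType) (A : {fset T1})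
    (B : {fset T2}) (u : T1 -> V) (v : T2 -> V) :
  \sum_(p <- A `*` B) u p.1 * v p.2 = (\sum_(x <- A) u x) * (\sum_(y <- B) v y).
Proof.
transitivity (\sum_(p <- [seq (x, y) | x <- A, y <- B]) u p.1 * v p.2).
  apply/perm_big/uniq_perm => [||[x y]]; first exact: fset_uniq.
    by rewrite allpairs_uniq ?fset_uniq// => -[? ?] [? ?] _ _.
  rewrite in_fsetM/=; apply/andP/allpairsPdep => [[xA yB]|].
    by exists x, y.
  by move=> [x' [y' [x'A y'B [-> ->]]]].
by rewrite big_allpairs mulr_suml; apply: eq_bigr => x _; rewrite mulr_sumr.
Qed.

Section Product.
Context {T1 T2 : choiceType} (f : T1 -> R[i]) (g : T2 -> R[i]).

(** A finite set of pairs lies in the rectangle of its two projections, over which the sum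
    factors. *)
Lemma abs_summableM : abs_summable f -> abs_summable g ->
  abs_summable (fun p : T1 * T2 => f p.1 * g p.2).
Proof.
move=> [M fM] [N gN]; exists (M * N) => Y.
pose A := [fset p.1 | p in Y]; pose B := [fset p.2 | p in Y].
have YAB : Y `<=` A `*` B.
  by apply/fsubsetP => p pY; rewrite in_fsetM !in_imfset.
apply: le_trans (sum_fset_le (fun=> normc_ge0 _) YAB) _.
under eq_bigr do rewrite normcM.
rewrite (sum_fsetM A B (fun x => normc (f x)) (fun y => normc (g y))).
by apply: ler_pM => //; apply: sumr_ge0 => *; exact: normc_ge0.
Qed.

(* The sum over the product exists by summability; it is then computed along the
   finite rectangles. *)
Lemma has_sum_prod l m : abs_summable f -> abs_summable g ->
  has_sum f l -> has_sum g m ->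
  has_sum (fun p : T1 * T2 => f p.1 * g p.2) (l * m).
Proof.
move=> af ag fl gm.
have [s fgs] := abs_summable_has_sum (abs_summableM af ag).
suff -> : l * m = s by [].
pose rect (P : {fset T1} * {fset T2}) := P.1 `*` P.2.
(* Rectangles are cofinal among the finite sets of pairs. *)
have rect_cvg : rect @ filter_prod totally totally --> totally.
  move=> U [Y _ YU].
  pose A := [fset p.1 | p in Y]; pose B := [fset p.2 | p in Y].
  exists ([set A' | A `<=` A'], [set B' | B `<=` B']).
    by split=> /=; [exists A | exists B].
  move=> [A' B'] /= [AA' BB']; apply: YU; apply/fsubsetP => p pY.
  rewrite in_fsetM (fsubsetP AA') ?(fsubsetP BB')//; exact: in_imfset.
pose G (P : {fset T1} * {fset T2}) : R[i]^o :=
  partial_sum f P.1 * partial_sum g P.2.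
have Gs : G @ filter_prod totally totally --> (s : R[i]^o).
  have -> : G = partial_sum (fun p : T1 * T2 => f p.1 * g p.2) \o rect.
    by apply/funext => -[A B]; rewrite /G /= !partial_sumE sum_fsetM.
  exact: cvg_comp rect_cvg fgs.
have Gf := cvg_comp _ _ (@cvg_fst _ _ totally _ (@totally_filter T2)) fl.
have Gg := cvg_comp _ _ (@cvg_snd _ _ _ totally (@totally_filter T1)) gm.
exact: norm_cvg_unique (cvgM Gf Gg) Gs.
Qed.

End Product.

(** If [A] controls the sum over the image, its preimage in [P], finite by injectivity, controls the
    sum over [P]. *)
Lemma has_sum_reindex {T1 T2 : choiceType} (P : set T1) (phi : T1 -> T2)
    (f : T2 -> R[i]) l :
  {in P &, injective phi} ->
  has_sum (zero_ext (phi @` P)%classic f) l ->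
  has_sum (zero_ext P (f \o phi)) l.
Proof.
move=> phi_inj /has_sumP fl; apply/has_sumP => e /fl[A AE].
have finA : finite_set (P `&` phi @^-1` [set` A])%classic.
  have inj : {in (P `&` phi @^-1` [set` A])%classic &, injective phi}.
    by move=> x y /[!inE] -[xP _] [yP _]; apply: phi_inj; rewrite inE.
  rewrite -(eq_finite_set (inj_card_eq inj)).
  by apply: sub_finite_set (finite_fset A) => _ [x [_ xA] <-].
exists (fset_set (P `&` phi @^-1` [set` A])%classic) => B AB.
pose B' := [fset x in B | x \in P]; pose D := [fset phi x | x in B'].
(* The control by [A] concerns supersets of [A], so [A] is joined to the image [D] of the part of
   [B] in [P]. *)
suff -> : \sum_(x <- B) (if x \in P then f (phi x) else 0) =
  \sum_(y <- A `|` D) (if y \in (phi @` P)%classic then f y else 0).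
  exact/AE/fsubsetUl.
transitivity (\sum_(x <- B') f (phi x)).
  transitivity (\sum_(x <- B') if x \in P then f (phi x) else 0).
    apply/esym/big_fset_incl => [|x xB].
      by apply/fsubsetP => x; rewrite !inE/= => /andP[].
    by rewrite !inE/= xB/= => /negbTE ->.
  apply: eq_fbigr => x; rewrite !inE/= => /andP[_ xP] _.
  by rewrite xP.
transitivity (\sum_(y <- D) if y \in (phi @` P)%classic then f y else 0).
  rewrite [RHS]big_imfset => [|x y].
    apply: eq_fbigr => x; rewrite !inE/= => /andP[_ xP] _.
    by rewrite mem_set//; exists x => //; exact: set_mem.
  by rewrite !inE/= => /andP[_ xP] /andP[_ yP]; exact: phi_inj.
(* The points of [A] outside [D] contribute 0: a point of [A] in the image of [P] has its preimage
   in [B], hence lies in [D]. *)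
apply: big_fset_incl => [|y]; first exact: fsubsetUr.
rewrite inE => /orP[yA yD|->//]; case: ifPn => //; rewrite inE => -[x xP xy].
have xB : x \in B.
  by apply: (fsubsetP AB); rewrite in_fset_set// inE; split=> //=; rewrite xy.
by move: yD; rewrite -xy in_imfset// !inE/= xB; exact/mem_set.
Qed.

End UnorderedSums.

(** * First return decomposition of walks *)

Local Open Scope classical_set_scope.
Local Open Scope ring_scope.

Section FirstReturn.
Context {R : realType}.

(** Passes to a subset and, at the same time, from a bound in [R[i]] to a bound in [R]. *)
Lemma abs_summable_ext {T : choiceType} (X Y : set T) (g : T -> R[i]) :
  Y `<=` X -> absolutely_summable X g -> abs_summable (zero_ext Y g).
Proof.
move=> YX [M XM]; exists M => A.
rewrite (_ : \sum_(x <- A) _ =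
    \sum_(x <- [fset x in A | x \in Y]%fset) normc (g x)).
  rewrite -lecR rmorph_sum; apply: XM => x.
  by rewrite !inE/= => /andP[_ /set_mem/YX].
transitivity (\sum_(x <- [fset x in A | x \in Y]%fset) normc (zero_ext Y g x)).
  apply/esym/big_fset_incl => [|x xA].
    by apply/fsubsetP => x; rewrite !inE/= => /andP[].
  by rewrite !inE/= xA/= /zero_ext => /negbTE ->; rewrite normc0.
by apply: eq_fbigr => x; rewrite !inE/= /zero_ext => /andP[_ ->].
Qed.

(* E restricts the last vertex: predT for the series D and A, pred1 v1 for B. *)
Definition W_end (E : pred vertex) n : set (seq vertex) :=
  [set w | W n w /\ E (nth v1 w n)].

Definition W_ret_end (E : pred vertex) n : set (seq vertex) :=
  [set w | W_ret n w /\ E (nth v1 w n)].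

(** The walks whose first return time is [k]; for distinct [k] these sets are disjoint. *)
Definition W_first (E : pred vertex) n k : set (seq vertex) :=
  [set w | [/\ W_end E n w, (0 < k <= n)%N, nth v1 w k = v1 &
               forall i, (0 < i < k)%N -> nth v1 w i <> v1]].

(** Concatenation of walks: the last vertex of the first is meant to be the head of the second, and
    is kept once. *)
Definition glue (p : seq vertex * seq vertex) := p.1 ++ behead p.2.

Lemma nth_glue_l (u v : seq vertex) k i : size u = k.+1 -> (i <= k)%N ->
  nth v1 (glue (u, v)) i = nth v1 u i.
Proof. by move=> su ik; rewrite /glue nth_cat su ltnS ik. Qed.

Lemma nth_glue_r (u v : seq vertex) k i : size u = k.+1 ->
  nth v1 u k = nth v1 v 0 -> nth v1 (glue (u, v)) (k + i) = nth v1 v i.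
Proof.
move=> su uv; case: i => [|i]; first by rewrite addn0 (nth_glue_l _ su).
rewrite /glue nth_cat su ltnS -[X in (_ <= X)%N]addn0 leq_add2l/=.
by rewrite addnS subSS addKn nth_behead.
Qed.

Lemma size_glue (u v : seq vertex) k m : size u = k.+1 -> size v = m.+1 ->
  size (glue (u, v)) = (k + m).+1.
Proof. by move=> su sv; rewrite /glue size_cat size_behead su sv. Qed.

(** Replaces the case distinction in [W_c] by the condition [0 < n], which makes length 0 empty. *)
Lemma W_cP n w : W_c n w <->
  [/\ W n w, (0 < n)%N, nth v1 w n = v1 &
      forall i, (0 < i < n)%N -> nth v1 w i <> v1].
Proof.
case: n => [|n]; first by split=> // -[].
by split=> [[? ? ? ?]|[[? ?] _ ? ?]].
Qed.

(** A walk is cut at its first return time [k]; conversely, the interior of the first piece avoids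
    [v1], so gluing makes [k] the first return. *)
Lemma glue_W_first E n k : (k <= n)%N ->
  glue @` (W_c k `*` W_end E (n - k)) = W_first E n k.
Proof.
move=> kn; apply/seteqP; split=> [_ [[u v] [/= uW vW] <-]|w].
  move/W_cP: uW => [[[su wu] u0] k0 uk ui].
  case: vW => -[[sv wv] v0] Ev.
  have uv : nth v1 u k = nth v1 v 0 by rewrite uk v0.
  split=> [||| i /andP[i0 ik]].
  - split; last by rewrite -[X in nth _ _ X](subnKC kn) (nth_glue_r _ su).
    split; last by rewrite (nth_glue_l _ su).
    split=> [|i /andP[i0 iN]]; first by rewrite (size_glue su sv) subnKC.
    (* The edge ending at position [i] comes from [u] if [i <= k], and otherwise from [v] with
       positions shifted by [k]. *)
    have [ik|ki] := leqP i k.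
      by rewrite !(nth_glue_l _ su)//; [apply: wu; rewrite i0 | lia].
    have -> : i.-1 = (k + (i - k).-1)%N by lia.
    rewrite -[X in _ != nth _ _ X](subnKC (ltnW ki)) !(nth_glue_r _ su)//.
    by apply: wv; lia.
  - by rewrite k0.
  - by rewrite (nth_glue_l _ su).
  - by rewrite (nth_glue_l _ su) 1?ltnW//; apply: ui; rewrite i0.
move=> [[[[sw ww] w0] Ew] /andP[k0 _] wk wi].
(* The two pieces overlap in the vertex at position [k]. *)
exists (take k.+1 w, drop k w) => /=; last first.
  by rewrite /glue/= -[RHS](cat_take_drop k.+1) -drop1 drop_drop add1n.
split=> /=.
  apply/W_cP; split=> //=; last 2 first.
  - by rewrite nth_take.
  - by move=> i /andP[i0 ik]; rewrite nth_take ?ltnS 1?ltnW//; apply: wi; lia.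
  split=> /=; last by rewrite nth_take.
  split=> [|i /andP[i0 ik]]; first by rewrite size_takel// sw.
  by rewrite !nth_take//; [apply: ww; lia | lia].
split=> /=; last by rewrite nth_drop subnKC.
split; last by rewrite nth_drop addn0.
split=> [|i /andP[i0 ik]]; first by rewrite size_drop sw subSn.
rewrite !nth_drop (_ : (k + i.-1)%N = (k + i).-1); last by lia.
by apply: ww; lia.
Qed.

(** As [k] fixes the length of the first piece, the cut is determined; the head dropped from the
    second piece is always [v1]. *)
Lemma glue_inj E n k : {in W_c k `*` W_end E (n - k) &, injective glue}.
Proof.
move=> [u v] [u' v'] /[!inE] -[/= /W_cP[[[su _] _] _ _ _] [[[sv _] v0] _]].
move=> -[/= /W_cP[[[su' _] _] _ _ _] [[[sv' _] v'0] _]].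
rewrite /glue/= => /eqP; rewrite eqseq_cat ?su// => /andP[/eqP -> /eqP vv'].
case: v v' sv sv' v0 v'0 vv' => [//|x v] [//|x' v'] _ _ /= -> -> ->.
by [].
Qed.

(** The first [k] edges are those of [u] and the remaining [m] those of [v]; sharing a vertex
    neither loses nor repeats an edge. *)
Lemma walk_weight_glue (h : edge -> R[i]) (u v : seq vertex) k m :
  size u = k.+1 -> size v = m.+1 -> nth v1 u k = nth v1 v 0 ->
  walk_weight h (glue (u, v)) = walk_weight h u * walk_weight h v.
Proof.
move=> su sv uv; rewrite /walk_weight (size_glue su sv) su sv.
rewrite (@big_cat_nat _ _ _ k.+1)//=; last by rewrite ltnS leq_addr.
congr (_ * _).
  by apply: eq_big_nat => i /andP[i0 ik]; rewrite !(nth_glue_l _ su)//; lia.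
rewrite -[X in \prod_(X <= _ < _) _]add1n big_addn subSn ?leq_addr// addKn.
apply: eq_big_nat => i /andP[i0 im].
rewrite -(nth_glue_r i su uv) -(nth_glue_r i.-1 su uv).
by rewrite [(i + k)%N]addnC (_ : (k + i.-1)%N = (k + i).-1)//; lia.
Qed.

(** A walk that returns has exactly one first return time, so at most one summand is nonzero. The
    summand for [k = 0] vanishes because [W_first] asks for [0 < k]. *)
Lemma W_ret_end_first E n (g : seq vertex -> R[i]) w :
  zero_ext (W_ret_end E n) g w = \sum_(k < n.+1) zero_ext (W_first E n k) g w.
Proof.
rewrite {1}/zero_ext; case: ifPn; last first.
  move=> wN; rewrite big1// => k _; rewrite /zero_ext ifN//.
  apply: contra wN; rewrite !inE => -[[Ww Ew] k0n wk _].
  by split=> //; split=> //; exists k.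
rewrite inE => -[[Ww [i i0n wi]] Ew].
pose Q j := (0 < j <= n)%N && (nth v1 w j == v1).
have exQ : exists j, Q j by exists i; rewrite /Q i0n wi eqxx.
have [k /andP[k0n /eqP wk] kmin] := ex_minnP exQ.
have kn : (k < n.+1)%N by case/andP: k0n.
rewrite (bigD1 (Ordinal kn))//= {1}/zero_ext ifT; last first.
  rewrite inE; split=> // j /andP[j0 jk] wj.
  suff : (k <= j)%N by rewrite leqNgt jk.
  by apply: kmin; rewrite /Q wj eqxx andbT; lia.
rewrite big1 ?addr0// => j jk; rewrite /zero_ext ifN//.
apply: contra jk; rewrite inE => -[_ j0n wj jmin]; apply/eqP/val_inj => /=.
apply/eqP; rewrite eqn_leq kmin ?andbT; last by rewrite /Q j0n wj eqxx.
rewrite leqNgt; apply/negP => kj; apply: (jmin k) => //.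
by case/andP: k0n => -> _.
Qed.

(** * Series identities for a light weight *)

Context (h : edge -> R[i]) (hl : light h).

Lemma abs_summable_W n (X : set (seq vertex)) : X `<=` W n ->
  abs_summable (zero_ext X (walk_weight h)).
Proof. by move=> XW; exact: abs_summable_ext XW (hl n). Qed.

Lemma has_sum_W n (X : set (seq vertex)) : X `<=` W n ->
  has_sum (zero_ext X (walk_weight h)) (set_weight h X).
Proof.
move=> /abs_summable_W/abs_summable_has_sum[l hX].
by rewrite /set_weight (has_sumE hX).
Qed.

Lemma W_c_sub n : W_c n `<=` W n.
Proof. by move=> w /W_cP[]. Qed.

Lemma W_end_sub E n : W_end E n `<=` W n.
Proof. by move=> w []. Qed.

(** The product of the two sums is a sum over pairs of walks, which [glue] carries bijectively and
    multiplicatively onto [W_first E n k]; uniqueness of sums identifies the values. *)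
Lemma has_sum_W_first E n k : (k <= n)%N ->
  has_sum (zero_ext (W_first E n k) (walk_weight h))
          (C_ h k * set_weight h (W_end E (n - k))).
Proof.
move=> kn; have W1 : W_first E n k `<=` W n by move=> w [[]].
have HS := has_sum_W W1.
suff -> : C_ h k * set_weight h (W_end E (n - k)) =
    set_weight h (W_first E n k) by [].
have := has_sum_prod (abs_summable_W (@W_c_sub k))
  (abs_summable_W (@W_end_sub E (n - k))) (has_sum_W (@W_c_sub k))
  (has_sum_W (@W_end_sub E (n - k))).
move/has_sum_unique; apply.
move: HS; rewrite -{1}glue_W_first// => /(has_sum_reindex (@glue_inj E n k)).
congr (has_sum _ _); apply/funext => -[u v].
rewrite /zero_ext/=; case: ifPn => [/set_mem[/= uW vW]|uvN].
  rewrite !mem_set//; case/W_cP: uW => -[[su _] _] _ uk _.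
  case: vW => -[[sv _] v0] _.
  by apply: walk_weight_glue su sv _; rewrite uk v0.
case: ifPn => [/set_mem uW|_]; last by rewrite mul0r.
case: ifPn => [/set_mem vW|_]; last by rewrite mulr0.
by case/negP: uvN; rewrite inE.
Qed.

Lemma first_return E n : set_weight h (W_ret_end E n) =
  cauchy_prod (C_ h) (fun m => set_weight h (W_end E m)) n.
Proof.
apply: has_sumE.
rewrite (_ : zero_ext _ _ =
    fun w => \sum_(k < n.+1) zero_ext (W_first E n k) (walk_weight h) w).
  by apply: has_sum_sum => k; apply: has_sum_W_first; rewrite -ltnS.
by apply/funext => w; exact: W_ret_end_first.
Qed.

Lemma A_cauchy_prod : A_ h = cauchy_prod (C_ h) (D_ h).
Proof.
have WE n : W_end predT n = W n by apply/seteqP; split=> w // -[].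
have WR n : W_ret_end predT n = W_ret n by apply/seteqP; split=> w // -[].
apply/funext => n; rewrite /A_ -WR first_return.
by apply: eq_bigr => k _; rewrite WE.
Qed.

Lemma B_0 : B_ h 0 = 1.
Proof.
have Wb0 : W_b 0 = [set [:: v1]].
  apply/seteqP; split=> [[|x [|y w]] [[]]//= _ _ ->//|_ ->].
  by split=> //; split=> // -[].
apply: has_sumE; apply/has_sumP => e e0; exists [fset [:: v1]]%fset => A vA.
rewrite -(big_fset_incl _ vA) => [|w _]; last first.
  rewrite Wb0 !inE => /eqP wv.
  by rewrite /zero_ext ifN//; apply/negP; rewrite inE.
rewrite big_seq_fset1 /zero_ext Wb0 mem_set//.
by rewrite /walk_weight big_geq// subrr normc0.
Qed.

(** A closed walk of positive length returns at its last step at the latest, so [first_return]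
    applies. The walk of length 0 has no return and accounts for the extra 1. *)
Lemma B_cauchy_prod n : B_ h n = (n == 0%N)%:R + cauchy_prod (C_ h) (B_ h) n.
Proof.
have WE m : W_end (pred1 v1) m = W_b m.
  by apply/seteqP; split=> w; [move=> [[? ?] /eqP]|move=> [? ? /eqP]].
case: n => [|n].
  (* At [n = 0] the product is [C_ h 0 * B_ h 0], and [C_ h 0] is a sum over the empty set. *)
  rewrite /cauchy_prod big_ord1 B_0 {1}/C_ /set_weight.
  rewrite (_ : unordered_sum _ _ = 0) ?mul0r ?addr0//.
  apply: has_sumE; rewrite (_ : zero_ext _ _ = fun=> 0); first exact: has_sum0.
  by apply/funext => w; rewrite /zero_ext in_set0.
have WR : W_ret_end (pred1 v1) n.+1 = W_b n.+1.
  apply/seteqP; split=> [w [[[? ?] _] /eqP]|w [? ? /eqP wn]] //.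
  by split=> //; split=> //; exists n.+1; [rewrite leqnn | exact/eqP].
rewrite add0r {1}/B_ -WR first_return.
by apply: eq_bigr => k _; rewrite WE.
Qed.

End FirstReturn.

Theorem theorem1 (R : realType) (h : edge -> R[i]) :
  light h ->
  value1_exists (D_ h) -> value1_exists (C_ h) ->
  value1_exists (B_ h) -> value1_exists (A_ h) ->
  value1 (B_ h) != 0 /\
  value1 (A_ h) = (1 - 1 / value1 (B_ h)) * value1 (D_ h).
Proof.
move=> hl cD cC cB cA.
have AE : value1 (A_ h) = value1 (C_ h) * value1 (D_ h).
  by move: cA; rewrite (A_cauchy_prod hl); exact: value1_cauchy_prod.
have psB : partial_sums (cauchy_prod (C_ h) (B_ h)) =
    fun n => partial_sums (B_ h) n - 1.
  apply/funext => n; apply/eqP; rewrite eq_sym subr_eq addrC; apply/eqP.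
  rewrite {1}/partial_sums (eq_bigr _ (fun i _ => B_cauchy_prod hl i)).
  rewrite big_split/=.
  by congr (_ + _); rewrite big_nat_recl//= big1 ?addr0.
(* The convergence of the product series, required by Abel's theorem, is inherited from that of
   [B_ h]. *)
have cCB : (partial_sums (cauchy_prod (C_ h) (B_ h)) : nat -> R[i]^o) @ \oo -->
    (value1 (B_ h) - 1 : R[i]^o).
  by rewrite psB; exact: cvgB cB (cvg_cst (1 : R[i]^o)).
have BE : value1 (B_ h) - 1 = value1 (C_ h) * value1 (B_ h).
  rewrite -(value1_cauchy_prod cC cB); last first.
    by apply/cvg_ex; exists (value1 (B_ h) - 1).
  exact/esym/(cvg_lim (@norm_hausdorff _ R[i]^o)).
have B0 : value1 (B_ h) != 0.
  (* If B(1) were 0, [BE] would read -1 = 0. *)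
  apply/eqP => B0; move/eqP: BE; rewrite B0 mulr0 sub0r oppr_eq0.
  by rewrite (negbTE (oner_neq0 _)).
(* It remains to see that C(1) = 1 - 1/B(1), which is [BE] after multiplication by B(1). *)
split=> //; rewrite AE; congr (_ * _); apply: (mulIf B0).
by rewrite -BE mulrBl mul1r mul1r mulVf.
Qed.
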